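(* Let $F$ be a finite collection of finite nonempty sets. Then $F$ is an hke collection if and only if for every subcollection $\Gamma$ of $F$ with at least two members there exists a partition $\{\Gamma_1,\Gamma_2\}$ of $\Gamma$ into two non-empty subcollections such that $$\Big|\bigcap\Gamma_1-\bigcup\Gamma_2\Big|=\Big|\bigcap\Gamma_2-\bigcup\Gamma_1\Big|.$$
   Context: A collection $F$ of sets is an hereditary Konig–Egervary (hke) collection if there is a positive integer $\alpha$ such that $|\bigcup\Gamma|+|\bigcap\Gamma|=2\alpha$ for every non-empty subcollection $\Gamma\subseteq F$. *)

(* Defs.v *)
From mathcomp Require Import all_boot.
From mathcomp Require Import finmap.

Set Implicit Arguments.
Unset Strict Implicit.
Unset Printing Implicit Defensive.

Local Open Scope fset_scope.

(* Carving the intersection out of the union is harmless when G is non-empty,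
   since every common element of the members then lies in the union.  The
   value fset0 taken at G = fset0 is a junk value. *)
Definition fintersection (K : choiceType) (G : {fset {fset K}}) : {fset K} :=
  [fset x in fcover G | [forall A : G, x \in val A]].

(* Restricting to finite collections of finite sets loses nothing: the
   identity for singleton subcollections forces every member to have
   cardinality alpha, and the identity for F itself forces the union of F to
   have at most 2 * alpha elements. *)
Definition hke (K : choiceType) (F : {fset {fset K}}) : Prop :=
  exists2 alpha : nat, (0 < alpha)%N &
    forall G : {fset {fset K}}, G `<=` F -> G != fset0 ->
      (#|` fcover G| + #|` fintersection G| = 2 * alpha)%N.

Definition partition2 (K : choiceType) (G G1 G2 : {fset {fset K}}) : Prop :=
  [/\ G1 != fset0, G2 != fset0, [disjoint G1 & G2] & G1 `|` G2 = G].

Lemma in_fcover (K : choiceType) (G : {fset {fset K}}) (x : K) :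
  reflect (exists2 A, A \in G & x \in A) (x \in fcover G).
Proof.
rewrite /fcover; apply: (iffP idP) => [/bigfcupP[A /andP[AG _] xA]|[A AG xA]].
  by exists A.
by apply/bigfcupP; exists A; rewrite ?AG.
Qed.

Lemma in_fintersection (K : choiceType) (G : {fset {fset K}}) (x : K) :
  G != fset0 ->
  reflect (forall A, A \in G -> x \in A) (x \in fintersection G).
Proof.
move=> G_neq0; rewrite !inE /=.
apply: (iffP andP) => [[_ /forallP xG] A AG|xG].
  exact: (xG [` AG]).
split; last by apply/forallP => A; apply/xG/valP.
by have /fset0Pn[B BG] := G_neq0; apply/in_fcover; exists B => //; apply: xG.
Qed.

(* Main.v *)
Require Import Defs.
From mathcomp Require Import all_boot finmap zify.

Local Open Scope fset_scope.

(**
  Write [f P Q] for the number of points lying in every member of [P] and in no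
  member of [Q].  Splitting according to membership in [A] gives
  [f P Q = f (P + A) Q + f P (Q + A)].  If every proper subcollection of [G]
  satisfies the identity |union| + |intersection| = 2 alpha, then moving members
  one at a time from one part of a partition [{P, Q}] of [G] to the other only
  changes the sign of [f P Q - f Q P], and for [Q] a singleton this difference
  is the defect of [G] in the identity.  So a balanced partition of [G] exists
  iff [G] satisfies the identity, iff all its partitions are balanced.
*)

Section ExactCard.
Set Implicit Arguments.
Unset Strict Implicit.
Variable K : choiceType.
Implicit Types (A B : {fset K}) (G P Q : {fset {fset K}}).

Lemma fcover1 A : fcover [fset A] = A.
Proof.
apply/fsetP => x; apply/in_fcover/idP => [[B]|xA]; last by exists A; rewrite ?inE.
by rewrite inE => /eqP ->.
Qed.

Lemma fcoverU1 A G : fcover (A |` G) = A `|` fcover G.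
Proof.
apply/fsetP => x; rewrite in_fsetU; apply/in_fcover/orP.
  move=> [B]; rewrite in_fset1U => /orP[/eqP-> | BG] xB; first by left.
  by right; apply/in_fcover; exists B.
move=> [xA | /in_fcover[B BG xB]]; first by exists A; rewrite ?fset1U1.
by exists B; rewrite // in_fset1U BG orbT.
Qed.

Lemma fset1U_neq0 A G : A |` G != fset0.
Proof. by apply/fset0Pn; exists A; rewrite fset1U1. Qed.

Lemma fset1_neq0 A : [fset A] != fset0.
Proof. by apply/fset0Pn; exists A; rewrite inE. Qed.

Lemma fintersection1 A : fintersection [fset A] = A.
Proof.
apply/fsetP => x.
apply/(in_fintersection _ (fset1_neq0 A))/idP => [|xA B].
  by apply; rewrite inE.
by rewrite inE => /eqP ->.
Qed.

Lemma fintersectionU1 A G :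
  G != fset0 -> fintersection (A |` G) = A `&` fintersection G.
Proof.
move=> G0; apply/fsetP => x; rewrite in_fsetI.
apply/(in_fintersection _ (fset1U_neq0 A G))/andP => [h | [xA /in_fintersection h] B].
  split; first by apply: h; rewrite fset1U1.
  by apply/in_fintersection => // B BG; apply: h; rewrite in_fset1U BG orbT.
by rewrite in_fset1U => /orP[/eqP -> //| ]; apply: h.
Qed.

Definition exact_card P Q := #|` fintersection P `\` fcover Q|.

(** [P] must be non-empty: at [fset0] the junk value of [fintersection] breaks the recursion for its
    intersection. *)
Lemma exact_card_split A P Q : P != fset0 ->
  (exact_card P Q = exact_card (A |` P) Q + exact_card P (A |` Q))%N.
Proof.
move=> P0; rewrite /exact_card fintersectionU1 // fcoverU1.
rewrite -(cardfsID A) fsetDDl (fsetUC _ A); congr (_ + _)%N.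
by rewrite fsetIC fsetIDA.
Qed.

Definition hke_at (alpha : nat) G :=
  (#|` fcover G| + #|` fintersection G| = 2 * alpha)%N.

Lemma hke_at1 A : hke_at #|` A| [fset A].
Proof. by rewrite /hke_at fcover1 fintersection1 mul2n addnn. Qed.

(** Both sides equal |U ∪ B| + |I|, with U and I the union and intersection of [P]. The additive
    form avoids truncated subtraction. *)
Lemma exact_card_fset1 P B : P != fset0 ->
  (exact_card P [fset B] + (#|` fcover (B |` P)| + #|` fintersection (B |` P)|)
  = exact_card [fset B] P + (#|` fcover P| + #|` fintersection P|))%N.
Proof.
move=> P0; rewrite /exact_card fcover1 fintersection1 fcoverU1 fintersectionU1 //.
have := cardfsID B (fintersection P).
have := cardfsID (fcover P) B; have := cardfsUI B (fcover P).
rewrite (fsetIC B (fintersection P)); lia.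
Qed.

Lemma exact_card_sym_iff alpha P Q :
  P != fset0 -> Q != fset0 -> [disjoint P & Q] ->
  (forall H, H `<` P `|` Q -> H != fset0 -> hke_at alpha H) ->
  exact_card P Q = exact_card Q P <-> hke_at alpha (P `|` Q).
Proof.
have [n] := ubnP #|` Q|; elim: n P Q => // n IHn P Q leQ P0 Q0 dPQ hH.
have [A AQ] := fset0Pn _ Q0.
have AnP : A \notin P by move: dPQ; rewrite fdisjoint_sym => /fdisjointP; apply.
have [Q'0 | Q'0] := eqVneq (Q `\ A) fset0.
  have QA : Q = [fset A] by rewrite -(fsetD1K AQ) Q'0 fsetU0.
  have := exact_card_fset1 A P0.
  (* The identity for [P] makes the last summand on the right of the exchange formula
     [2 * alpha]. *)
  have /hH/(_ P0) : P `<` P `|` Q.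
    by rewrite QA fproperUl // fsub1set.
  rewrite /hke_at QA (fsetUC P); lia.
move: dPQ hH leQ; rewrite -(fsetD1K AQ).
have : A \notin Q `\ A by rewrite !inE eqxx.
move: (Q `\ A) Q'0 => Q' Q'0 AnQ' dPQ hH leQ.
have ltQ' : (#|` Q'| < n)%N by move: leQ; rewrite cardfsU1 AnQ'; lia.
have dPQ' : [disjoint P & Q'] by apply: fdisjointWr dPQ; apply: fsubsetUr.
have ltU : P `|` Q' `<` P `|` (A |` Q').
  by rewrite fsetUCA fproperUr // fsub1set in_fsetU negb_or AnP.
(* Without [A] the collection is proper, so it satisfies the identity and is balanced by
   induction. *)
have symPQ' : exact_card P Q' = exact_card Q' P.
  apply/(IHn P Q') => // [H ltH|]; last by apply: hH => //; rewrite fsetU_eq0 negb_and P0.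
  by apply: hH; apply: fproper_sub_trans (fproper_sub ltU).
have dAPQ' : [disjoint A |` P & Q'].
  by rewrite fdisjointU1X AnQ'.
(* Moving [A] across keeps the union. Splitting both sides of [symPQ'] by [A] shows that balance
   before and after the move are equivalent. *)
have := IHn (A |` P) Q' ltQ' (fset1U_neq0 _ _) Q'0 dAPQ'.
rewrite -fsetUA (fsetUCA [fset A]) => /(_ hH) <-.
have := exact_card_split A Q' P0; have := exact_card_split A P Q'0; lia.
Qed.

(** Both parts are singletons, and |C - D| = |D - C| forces |C| = |D|. Applied to pairs in [F], this
    yields the common cardinality that serves as [alpha]. *)
Lemma pair_partition_card A B G1 G2 :
  A != B -> partition2 [fset A; B] G1 G2 ->
  exact_card G1 G2 = exact_card G2 G1 -> #|` A| = #|` B|.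
Proof.
move=> AB [G1n0 G2n0 dG eG] ec.
have cG : (#|` G1| + #|` G2| = 2)%N.
  by rewrite -cardfsUI eG (eqP dG) cardfs0 cardfs2 AB.
have [] : #|` G1| = 1%N /\ #|` G2| = 1%N.
  by move: G1n0 G2n0; rewrite -!cardfs_gt0; lia.
move=> /eqP/cardfs1P[C eC] /eqP/cardfs1P[D eD].
move: ec; rewrite eC eD /exact_card !fcover1 !fintersection1 => ec.
have cCD : #|` C| = #|` D|.
  by have := cardfsID D C; have := cardfsID C D; rewrite (fsetIC C D); lia.
have : A \in [fset A; B] by rewrite !inE eqxx.
have : B \in [fset A; B] by rewrite !inE eqxx orbT.
by rewrite -eG eC eD !inE => /orP[]/eqP-> /orP[]/eqP->.
Qed.

End ExactCard.

Theorem theorem3p1 (K : choiceType) (F : {fset {fset K}})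
    (F_nonempty : forall A : {fset K}, A \in F -> A != fset0) :
  hke F <->
  (forall G : {fset {fset K}}, G `<=` F -> (2 <= #|` G|)%N ->
     exists G1 G2 : {fset {fset K}},
       partition2 G G1 G2 /\
       #|` fintersection G1 `\` fcover G2|
         = #|` fintersection G2 `\` fcover G1|).
Proof.
split=> [[alpha _ hF] G GF G2 | hP].
  have /fset0Pn[A AG] : G != fset0 by rewrite -cardfs_gt0; lia.
  have eG : [fset A] `|` G `\ A = G by apply: fsetD1K.
  have A0 := fset1_neq0 A.
  have G'0 : G `\ A != fset0.
    by move: G2; rewrite -cardfs_gt0 (cardfsD1 A) AG; lia.
  have dG : [disjoint [fset A] & G `\ A].
    by rewrite fdisjoint1X !inE eqxx.
  (* Every partition is balanced here; isolating one member is a convenient choice. *)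
  exists [fset A], (G `\ A); split=> //.
  apply/(@exact_card_sym_iff K alpha) => // [H|]; rewrite eG.
    by move=> /fproper_sub HG; apply: hF; apply: fsubset_trans GF.
  by apply: hF => //; rewrite -cardfs_gt0; lia.
have [-> | /fset0Pn[A0 A0F]] := eqVneq F fset0.
  by exists 1%N => // G; rewrite fsubset0 => ->.
have cF A : A \in F -> #|` A| = #|` A0|.
  move=> AF; have [-> // | AA0] := eqVneq A A0.
  have [||G1 [G2 [pG ec]]] := hP [fset A; A0].
  - by apply/fsubsetP => B; rewrite !inE => /orP[]/eqP->.
  - by rewrite cardfs2 AA0.
  exact: pair_partition_card pG ec.
(* Singleton subcollections force this value of [alpha]. *)
exists #|` A0|; first by rewrite cardfs_gt0 F_nonempty.
move=> G; have [n] := ubnP #|` G|; elim: n G => // n IHn G ltG GF G0.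
have [G2 | ] := leqP 2 #|` G|.
  have [G1 [G2' [[n1 n2 d eG] ec]]] := hP G GF G2.
  suff : hke_at #|` A0| (G1 `|` G2') by rewrite eG.
  apply/exact_card_sym_iff => // H; rewrite eG => ltH H0.
  apply: IHn => //; last exact: fsubset_trans (fproper_sub ltH) GF.
  by have := fproper_ltn_card ltH; lia.
rewrite -cardfs_gt0 in G0 => lt2.
have /cardfs1P[A eA] : #|` G| == 1%N by lia.
have AF : A \in F by apply: (fsubsetP GF); rewrite eA inE.
by rewrite eA -(cF A AF); apply: hke_at1.
Qed.
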